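(* Let $\mathbb{F}$ be a field of characteristic $0$, let $n\ge3$ be an integer and let $\ell_1,\ell_2\in\mathbb{N}$. Let $V_{\ell_1,\ell_2}$ be the $sl(n,\mathbb{F})$-submodule generated by $x_1^{\ell_1}y_n^{\ell_2}$ in $\mathbb{F}[x_1,\dots,x_n,y_1,\dots,y_n]$, for the action given in the context. The set $$\Big\{\sum_{i_2,\dots,i_n=0}^\infty\frac{(-1)^{i_2+\cdots+i_n}\prod_{r=2}^n\binom{m_r}{i_r}\binom{l_r}{i_r}}{\binom{m+i_2+\cdots+i_n}{m}\binom{i_2+\cdots+i_n}{i_2,\dots,i_n}}\,x_1^{m+i_2+\cdots+i_n}y_1^{i_2+\cdots+i_n}\prod_{r=2}^nx_r^{m_r-i_r}y_r^{l_r-i_r},$$ $$\sum_{i_2,\dots,i_n=0}^\infty\frac{(-1)^{i_2+\cdots+i_n}\prod_{r=2}^n\binom{m_r'}{i_r}\binom{l_r'}{i_r}}{\binom{m'+i_2+\cdots+i_n}{m'}\binom{i_2+\cdots+i_n}{i_2,\dots,i_n}}\,x_1^{i_2+\cdots+i_n}y_1^{m'+i_2+\cdots+i_n}\prod_{r=2}^nx_r^{m_r'-i_r}y_r^{l_r'-i_r}$$ $$\Big|\ m,m',m_r,l_r,m_r',l_r'\in\mathbb{N};\ m+\sum_{r=2}^nm_r=\sum_{r=2}^nm_r'=\ell_1,\ \sum_{r=2}^nl_r=m'+\sum_{r=2}^nl_r'=\ell_2\Big\}$$ forms a basis of $V_{\ell_1,\ell_2}$.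
   Context: $\mathbb{N}$ is the set of nonnegative integers; $\binom{N}{i_2,\dots,i_n}=\frac{N!}{i_2!\cdots i_n!}$ (with $i_2+\cdots+i_n=N$) is the multinomial coefficient; $\binom{m}{i}=0$ for $i>m\ge0$, and such terms are zero. The displayed collection is understood as a set (elements occurring in both families, when $m=m'=0$, are counted once). $E_{i,j}$ denotes the $n\times n$ matrix with $1$ in the $(i,j)$-entry and $0$ elsewhere. The Lie algebra $sl(n,\mathbb{F})$ acts on $\mathbb{F}[x_1,\dots,x_n,y_1,\dots,y_n]$ by (the restriction to traceless matrices of the linear extension of) $E_{i,j}\mapsto x_i\partial_{x_j}-y_j\partial_{y_i}$ for $i,j\in\{1,\dots,n\}$. *)

(* Defs.v *)
From HB Require Import structures.
From mathcomp Require Import all_boot all_order all_algebra.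
From mathcomp Require Import mpoly.

Set Implicit Arguments.
Unset Strict Implicit.
Unset Printing Implicit Defensive.

Import GRing.Theory.

Local Open Scope ring_scope.

(* F[x_1..x_n, y_1..y_n] is {mpoly F[n + n]}: the first n variables are the
   x's and the last n the y's.  Indices are 0-based. *)
Section Action.
Variables (F : fieldType) (n : nat).

Definition xvar (i : 'I_n) : {mpoly F[n + n]} := 'X_(lshift n i).
Definition yvar (i : 'I_n) : {mpoly F[n + n]} := 'X_(rshift n i).
Definition dx (i : 'I_n) (p : {mpoly F[n + n]}) := mderiv (lshift n i) p.
Definition dy (i : 'I_n) (p : {mpoly F[n + n]}) := mderiv (rshift n i) p.

(* Linear extension to all matrices of
   E_(i,j) |-> x_i d/dx_j - y_j d/dy_i. *)
Definition gl_act (A : 'M[F]_n) (p : {mpoly F[n + n]}) : {mpoly F[n + n]} :=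
  \sum_(i < n) \sum_(j < n) A i j *: (xvar i * dx j p - yvar j * dy i p).

(* Only traceless matrices are required to act, hence sl rather than gl. *)
Definition sl_submodule (W : {mpoly F[n + n]} -> Prop) : Prop :=
  [/\ W 0,
      forall (a : F) p q, W p -> W q -> W (a *: p + q) &
      forall (A : 'M[F]_n) p, \tr A = 0 -> W p -> W (gl_act A p)].

Definition sl_generated (g p : {mpoly F[n + n]}) : Prop :=
  forall W, sl_submodule W -> W g -> W p.

End Action.

(* {mpoly F[n + n]} is not a vectType, so mathcomp's basis_of is not
   available. *)
Section Basis.
Variables (F : fieldType) (V : lmodType F).

Definition lin_indep (B : V -> Prop) : Prop :=
  forall (s : seq V) (c : V -> F),
    uniq s -> (forall v, v \in s -> B v) ->
    \sum_(v <- s) c v *: v = 0 -> forall v, v \in s -> c v = 0.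

Definition in_span (B : V -> Prop) (w : V) : Prop :=
  exists (s : seq V) (c : V -> F),
    (forall v, v \in s -> B v) /\ w = \sum_(v <- s) c v *: v.

Definition is_basis (B W : V -> Prop) : Prop :=
  lin_indep B /\ forall w, W w <-> in_span B w.

End Basis.

(* Here n = k.+1.  The tuples indexed by r = 2..n (exponents m_r, l_r and
   summation indices i_r) are elements of 'X_{1..k}; the variable x_r attached
   to r : 'I_k is xvar (lift ord0 r), and i_2 + ... + i_n is mdeg i. *)
Section BasisElements.
Variables (F : fieldType) (k : nat).

Definition multinomial (i : 'X_{1..k}) : nat :=
  ((mdeg i)`! %/ \prod_(r < k) (i r)`!)%N.

Definition bcoef (m : nat) (mm ll i : 'X_{1..k}) : F :=
  (-1) ^+ mdeg i * (\prod_(r < k) ('C(mm r, i r) * 'C(ll r, i r)))%N%:R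
  / ('C(m + mdeg i, m) * multinomial i)%N%:R.

(* The exponents use truncated subtraction, but whenever i r exceeds mm r or
   ll r the coefficient bcoef vanishes. *)
Definition bmonom (a b : nat) (mm ll i : 'X_{1..k}) :
    {mpoly F[k.+1 + k.+1]} :=
  xvar F ord0 ^+ a * yvar F ord0 ^+ b *
  \prod_(r < k) (xvar F (lift ord0 r) ^+ (mm r - i r) *
                 yvar F (lift ord0 r) ^+ (ll r - i r)).

Definition xterm (m : nat) (mm ll i : 'X_{1..k}) :=
  bcoef m mm ll i *: bmonom (m + mdeg i) (mdeg i) mm ll i.

Definition yterm (m : nat) (mm ll i : 'X_{1..k}) :=
  bcoef m mm ll i *: bmonom (mdeg i) (m + mdeg i) mm ll i.

(* The sums over all i_2, ..., i_n >= 0 have finite support: every nonzero term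
   has i_2 + ... + i_n <= m_2 + ... + m_n (see belem_trunc below). *)
Definition xelem (m : nat) (mm ll : 'X_{1..k}) : {mpoly F[k.+1 + k.+1]} :=
  \sum_(i : 'X_{1..k < (mdeg mm).+1}) xterm m mm ll i.

Definition yelem (m : nat) (mm ll : 'X_{1..k}) : {mpoly F[k.+1 + k.+1]} :=
  \sum_(i : 'X_{1..k < (mdeg mm).+1}) yterm m mm ll i.

Definition basis_set (l1 l2 : nat) (p : {mpoly F[k.+1 + k.+1]}) : Prop :=
  (exists (m : nat) (mm ll : 'X_{1..k}),
     [/\ (m + mdeg mm)%N = l1, mdeg ll = l2 & p = xelem m mm ll]) \/
  (exists (m' : nat) (mm' ll' : 'X_{1..k}),
     [/\ mdeg mm' = l1, (m' + mdeg ll')%N = l2 & p = yelem m' mm' ll']).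

Lemma bcoef_eq0 m (mm ll i : 'X_{1..k}) r :
  (mm r < i r)%N || (ll r < i r)%N -> bcoef m mm ll i = 0.
Proof.
move=> h; rewrite /bcoef (bigD1 r) //=.
by case/orP: h => /bin_small ->; rewrite ?muln0 !mul0n mulr0 mul0r.
Qed.

Lemma bcoef_mdeg m (mm ll i : 'X_{1..k}) :
  (mdeg mm < mdeg i)%N -> bcoef m mm ll i = 0.
Proof.
move=> h; have [/existsP [r hr]|/existsPn hN] :=
  boolP [exists r, mm r < i r]%N.
  by apply: (@bcoef_eq0 _ _ _ _ r); rewrite hr.
move: h; rewrite ltnNge !mdegE; case/negP.
by apply: leq_sum => r _; rewrite leqNgt.
Qed.

Lemma big_bmultinom_trunc (M : nmodType) (E : 'X_{1..k} -> M) d K :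
  (d < K)%N -> (forall i, (d < mdeg i)%N -> E i = 0) ->
  \sum_(i : 'X_{1..k < K}) E i = \sum_(i : 'X_{1..k < d.+1}) E i.
Proof.
move=> dK E0.
have widP (i : 'X_{1..k < d.+1}) : (mdeg i < K)%N.
  by apply: leq_trans dK; apply: bmdeg.
rewrite (bigID (fun i : 'X_{1..k < K} => mdeg i < d.+1)%N) /=.
rewrite [X in _ + X]big1 ?addr0; last by move=> i; rewrite -leqNgt => /E0.
rewrite (reindex_onto (fun i : 'X_{1..k < d.+1} => BMultinom (widP i))
  (fun i => insubd (bm0 : 'X_{1..k < d.+1}) (bmnm i))) /=.
  apply: eq_bigl => i; rewrite bmdeg /=.
  by apply/eqP/val_inj; rewrite /= val_insubd bmdeg.
by move=> i hi; apply/val_inj; rewrite /= val_insubd hi.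
Qed.

Lemma belem_trunc m (mm ll : 'X_{1..k}) K : (mdeg mm < K)%N ->
  \sum_(i : 'X_{1..k < K}) xterm m mm ll i = xelem m mm ll /\
  \sum_(i : 'X_{1..k < K}) yterm m mm ll i = yelem m mm ll.
Proof.
by move=> h; split; apply: big_bmultinom_trunc => // i hi;
   rewrite /xterm /yterm bcoef_mdeg // scale0r.
Qed.

End BasisElements.

(* Main.v *)
From HB Require Import structures.
Require Import Defs.
From mathcomp Require Import all_boot all_order all_algebra.
From mathcomp Require Import mpoly.
From mathcomp Require Import ring zify.

Set Implicit Arguments.
Unset Strict Implicit.
Unset Printing Implicit Defensive.

Import GRing.Theory.

Local Open Scope ring_scope.

(* The submodule and the span of the family are both the space of harmonic
   polynomials, i.e. those killed by lap = sum_i d/dx_i d/dy_i, of bidegree (l1, l2).  The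
   operator lap commutes with the action, and a harmonic polynomial is determined
   by its leading coefficients, those of the monomials not divisible by x_1 y_1.
   Each element of the family is harmonic and has exactly one leading monomial,
   with coefficient 1, and every leading monomial of bidegree (l1, l2) occurs
   once; hence the family is a basis of the harmonic polynomials.

   It remains to reach every element from x_1^l1 y_n^l2.  The E_(i,j) with
   i, j >= 2 lead to all x_1^l1 y^b.  If p is the element with leading monomial
   x_1^a u, a > 0, then E_(j,1) p is a times the one with leading monomial
   x_1^(a-1) x_j u, so that all elements of the first kind are obtained.  Since
   n >= 3, one also reaches x_r^l1 y_1^l2 for some r other than 1 and n, and then
   the elements of the second kind by exchanging the roles of x and y. *)

(** Makes the division in [multinomial] exact; each inductive step is the integrality of one
    binomial coefficient. *)
Lemma dvdn_prod_fact_sum (I : Type) (r : seq I) (f : I -> nat) :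
  (\prod_(i <- r) (f i)`! %| (\sum_(i <- r) f i)`!)%N.
Proof.
elim/big_rec2: _ => [|i a b _ h]; first by rewrite fact0.
have := bin_fact (leq_addr a (f i)); rewrite addKn => <-.
by rewrite dvdn_mull // dvdn_mul.
Qed.

(** * Coefficients of the family and their recurrence *)

Section Coefficients.
Variables (F : fieldType) (charF0 : [pchar F] =i pred0) (k : nat).
Implicit Types i mm ll : 'X_{1..k}.

Lemma natr_neq0 m : (m != 0%N) -> m%:R != 0 :> F.
Proof. by move/pcharf0P: charF0 => ->. Qed.

Lemma multinomial_prod_fact i :
  (multinomial i * \prod_(r < k) (i r)`! = (mdeg i)`!)%N.
Proof. by rewrite /multinomial divnK // mdegE dvdn_prod_fact_sum. Qed.

Lemma bcoef0 m mm ll : bcoef F m mm ll 0%MM = 1.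
Proof.
rewrite /bcoef /multinomial mdeg0 addn0 binn expr0 mul1r.
rewrite !big1; last 2 first.
- by move=> r _; rewrite mnm0E.
- by move=> r _; rewrite mnm0E !bin0.
by rewrite divn1 divr1.
Qed.

Lemma prod_bin_addU mm ll i (r : 'I_k) :
  ((\prod_(s < k) ('C(mm s, i s) * 'C(ll s, i s))) *
     ((mm r - i r) * (ll r - i r)) =
   (\prod_(s < k) ('C(mm s, (i + U_(r))%MM s) * 'C(ll s, (i + U_(r))%MM s))) *
     ((i r).+1 * (i r).+1))%N.
Proof.
rewrite (bigD1 r) //= [in RHS](bigD1 r) //=.
rewrite !mnmDE mnm1E eqxx addn1.
have := mul_bin_left (mm r) (i r); have := mul_bin_left (ll r) (i r).
move=> e1 e2.
under [in RHS]eq_bigr => s sr do rewrite mnmDE mnm1E eq_sym (negPf sr) addn0.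
rewrite mulnAC mulnACA [(_ * (mm r - _))%N]mulnC [(_ * (ll r - _))%N]mulnC.
by rewrite -e1 -e2; nia.
Qed.

Lemma prod_fact_addU i (r : 'I_k) :
  (\prod_(s < k) ((i + U_(r))%MM s)`! = (i r).+1 * \prod_(s < k) (i s)`!)%N.
Proof.
rewrite (bigD1 r) //= [in RHS](bigD1 r) //= mnmDE mnm1E eqxx addn1 factS.
under eq_bigr => s sr do rewrite mnmDE mnm1E eq_sym (negPf sr) addn0.
by rewrite mulnA.
Qed.

(** The denominator of [bcoef] is (m+|i|)! divided by m! prod i_r!; in this form raising one i_r
    alters few factors. *)
Lemma bcoefE m mm ll i :
  bcoef F m mm ll i =
  (-1) ^+ mdeg i * (\prod_(r < k) ('C(mm r, i r) * 'C(ll r, i r)))%:R *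
    (m`! * \prod_(r < k) (i r)`!)%:R / (m + mdeg i)`!%:R.
Proof.
have h : ((m + mdeg i)`! =
    'C(m + mdeg i, m) * multinomial i * (m`! * \prod_(r < k) (i r)`!))%N.
  rewrite mulnACA multinomial_prod_fact.
  by rewrite -(bin_fact (leq_addr (mdeg i) m)) addKn mulnA.
have /natr_neq0 := lt0n_neq0 (fact_gt0 (m + mdeg i)).
rewrite /bcoef h (natrM _ (_ * multinomial _)) mulf_eq0 negb_or.
move: (_ ^+ _) (\prod_(_ < _) (_ * _))%:R (_%:R) (_%:R) => x y c d /andP[c0 d0].
by field; rewrite c0 d0.
Qed.

(** This recurrence lets d/dx_r d/dy_r of the term at i cancel against a part of d/dx_1 d/dy_1 of
    the term at i + U_r. *)
Lemma bcoef_addU m mm ll i (r : 'I_k) :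
  bcoef F m mm ll i * ((mm r - i r) * (ll r - i r))%:R =
  - ((m + mdeg i).+1 * (i r).+1)%:R * bcoef F m mm ll (i + U_(r))%MM.
Proof.
have /natr_neq0 := lt0n_neq0 (fact_gt0 (m + mdeg i)).
have : (m + mdeg i).+1%:R != 0 :> F by exact: natr_neq0.
have := congr1 (fun n => n%:R : F) (prod_bin_addU mm ll i r).
rewrite !bcoefE prod_fact_addU mdegD mdeg1 addn1 addnS factS exprS !natrM.
set B := (\prod_(_ < _) _)%:R; set B' := (\prod_(_ < _) _)%:R.
set f := _`!%:R; set P := (\prod_(_ < _) _)%:R; set g := _`!%:R.
set u := _.+1%:R; set v := _.+1%:R; set a := (_ - _)%:R; set b := (_ - _)%:R.
set sgn := _ ^+ _.
move: B B' f P g u v a b sgn => B B' f P g u v a b sgn e v0 f0.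
have -> : sgn * B * (g * P) / f * (a * b) = sgn * (B * (a * b)) * (g * P) / f.
  by ring.
by rewrite e; field; rewrite v0 f0.
Qed.

End Coefficients.

(** * Coefficients and derivatives of a variable times a polynomial *)

Section Variables.
Variables (R : comNzRingType) (n : nat).
Implicit Types (p q : {mpoly R[n]}) (m : 'X_{1..n}) (s t : 'I_n).

Lemma submUK s m : (0 < m s)%N -> (m - U_(s) + U_(s))%MM = m.
Proof.
move=> ms; apply: submK; apply/mnm_lepP => t.
by rewrite mnm1E; case: eqP => // <-.
Qed.

Lemma mcoeffXM s q m :
  ('X_s * q)@_m = if (0 < m s)%N then q@_(m - U_(s)) else 0.
Proof.
case: ifP => ms.
  by rewrite -{1}(submUK ms) addmC mulrC mcoeffMX.
apply: memN_msupp_eq0; rewrite mulrC (perm_mem (msuppMX q _)).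
by apply/mapP => -[m' _ e]; move: ms; rewrite e mnmDE mnm1E eqxx.
Qed.

Lemma mderivXM s t q : ('X_s * q)^`M(t) = (s == t)%:R *: q + 'X_s * q^`M(t).
Proof.
rewrite mderivM mderivX mnm1E; case: eqP => [->|_]; last first.
  by rewrite !scale0r mul0r.
suff -> : (U_(t) - U_(t))%MM = 0%MM :> 'X_{1..n}.
  by rewrite mpolyX0 !scale1r mul1r.
by apply/mnmP => u; rewrite mnmBE mnm0E subnn.
Qed.

End Variables.

(** * The two sides of variables, and the commutation of [lap] with the action *)

Section Sides.
Variables (F : fieldType) (n : nat).
Implicit Types (p q : {mpoly F[n + n]}) (m : 'X_{1..n + n}) (i j t : 'I_n).
Implicit Types z : bool.

(* The x's form the side [true] and the y's the side [false]. *)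
Definition var z i : 'I_(n + n) := if z then lshift n i else rshift n i.
Arguments var : simpl never.

Lemma eq_var z z' i j : (var z i == var z' j) = (z == z') && (i == j).
Proof.
case: z z' => [] []; rewrite /var;
  by rewrite ?eq_lshift ?eq_rshift ?eq_lrshift ?eq_rlshift.
Qed.

Lemma varP (P : 'I_(n + n) -> Prop) :
  (forall z i, P (var z i)) -> forall s, P s.
Proof.
move=> h s; case: (split_ordP s) => i ->; [exact: (h true)|exact: (h false)].
Qed.

Definition sdeg z m := (\sum_i m (var z i))%N.

Lemma sdegD z m m' : sdeg z (m + m')%MM = (sdeg z m + sdeg z m')%N.
Proof. by rewrite /sdeg -big_split; apply: eq_bigr => i _; rewrite mnmDE. Qed.

Lemma sdegU z z' i : sdeg z U_(var z' i)%MM = (z == z').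
Proof.
rewrite /sdeg (bigD1 i) //= mnm1E eq_var eqxx andbT big1 ?addn0 1?eq_sym //.
by move=> j ji; rewrite mnm1E eq_var eq_sym [i == j]eq_sym (negPf ji) andbF.
Qed.

Lemma sdegMn z m c : sdeg z (m *+ c)%MM = (sdeg z m * c)%N.
Proof. by rewrite /sdeg big_distrl; apply: eq_bigr => i _; rewrite mulmnE. Qed.

Definition lap p := \sum_i (p^`M(var true i))^`M(var false i).

Lemma lapE z p : lap p = \sum_i (p^`M(var (~~ z) i))^`M(var z i).
Proof. by case: z => //; apply: eq_bigr => i _; rewrite mderiv_comm. Qed.

Lemma lap_is_linear : linear lap.
Proof.
move=> a p q; rewrite /lap scaler_sumr -big_split; apply: eq_bigr => i _ /=.
by rewrite !mderivD !mderivZ.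
Qed.
HB.instance Definition _ :=
  GRing.isLinear.Build F {mpoly F[n + n]} {mpoly F[n + n]} _ lap lap_is_linear.

Lemma mcoeff_lap p m :
  (lap p)@_m = \sum_i p@_(m + U_(var false i) + U_(var true i)) *+
                 ((m (var true i)).+1 * (m (var false i)).+1).
Proof.
rewrite /lap raddf_sum; apply: eq_bigr => i _ /=.
by rewrite !mcoeff_deriv mnmDE mnm1E eq_var addn0 -mulrnA.
Qed.

(* [op true i j] is the action of E_(i,j) and [op false i j] that of
   - E_(j,i). *)
Definition op z i j p :=
  'X_(var z i) * p^`M(var z j) - 'X_(var (~~ z) j) * p^`M(var (~~ z) i).

Lemma opN z i j p : op (~~ z) i j p = - op z j i p.
Proof. by rewrite /op negbK opprB. Qed.

Lemma op_is_linear z i j : linear (op z i j).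
Proof.
move=> a p q; rewrite /op !mderivD !mderivZ scalerBr !mulrDr -!scalerAr.
by rewrite opprD addrACA.
Qed.
HB.instance Definition _ z i j :=
  GRing.isLinear.Build F {mpoly F[n + n]} {mpoly F[n + n]} _ (op z i j)
    (op_is_linear z i j).

Lemma gl_actE (A : 'M[F]_n) p :
  gl_act A p = \sum_i \sum_j A i j *: op true i j p.
Proof. by []. Qed.

Lemma gl_act_delta i j p : gl_act (delta_mx i j) p = op true i j p.
Proof.
rewrite gl_actE (bigD1 i) //= (bigD1 j) //= mxE !eqxx scale1r.
rewrite big1 ?addr0 => [|t ti]; last by rewrite mxE eqxx (negPf ti) scale0r.
rewrite big1 ?addr0 // => t ti; rewrite big1 // => u _.
by rewrite mxE (negPf ti) scale0r.
Qed.

Lemma sl_submodule_op W z i j p :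
  sl_submodule W -> i != j -> W p -> W (op z i j p).
Proof.
move=> [W0 Wl Wg] ij Wp.
have Wop i' j' : i' != j' -> W (op true i' j' p).
  move=> ij'; rewrite -gl_act_delta; apply: Wg => //.
  rewrite /mxtrace big1 // => t _; rewrite mxE.
  by case: eqP => //= ->; rewrite (negPf ij').
case: z; first exact: Wop.
rewrite (opN true) -[- _]addr0 -scaleN1r; apply: Wl => //.
by apply: Wop; rewrite eq_sym.
Qed.

(** By the Leibniz rule an extra term arises only at t = i from the first product and at t = j from
    the second; both are the same mixed second derivative of [p] and cancel. *)
Lemma lap_op z i j p : lap (op z i j p) = op z i j (lap p).
Proof.
rewrite /op !(lapE z) !(big_morph _ (mderivD _) (mderiv0 _ _)).
transitivity (\sum_t ((t == i)%:R *: p^`M(var (~~ z) t)^`M(var z j)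
    - (t == j)%:R *: p^`M(var z t)^`M(var (~~ z) i)
    + ('X_(var z i) * p^`M(var (~~ z) t)^`M(var z t)^`M(var z j)
    - 'X_(var (~~ z) j) * p^`M(var (~~ z) t)^`M(var z t)^`M(var (~~ z) i)))).
  apply: eq_bigr => t _. rewrite !mderivB !mderivXM !eq_var.
  have -> : (z == ~~ z) = false by case: z.
  rewrite !eqxx /= !scale0r !add0r !mderivD. rewrite !mderivZ !mderivXM !eq_var.
  have -> : (~~ z == z) = false by case: z.
  rewrite eqxx /= !scale0r !add0r [i == t]eq_sym [j == t]eq_sym opprD addrACA.
  congr (_ *: _ - _ *: _ + (_ * _ - _ * _)).
  - by rewrite mderiv_comm.
  - by rewrite mderiv_comm.
  - by rewrite (mderiv_comm (var z j) (var (~~ z) t)) (mderiv_comm (var z j)).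
  - rewrite (mderiv_comm (var (~~ z) i) (var (~~ z) t)).
    by rewrite (mderiv_comm (var (~~ z) i)).
rewrite !big_split /= sumrN sumrN -!mulr_sumr.
rewrite (bigD1 i) //= big1 => [|t /negPf->]; last by rewrite scale0r.
rewrite (bigD1 j) //= big1 => [|t /negPf->]; last by rewrite scale0r.
by rewrite !eqxx !scale1r !addr0 mderiv_comm subrr add0r.
Qed.

End Sides.

Arguments var : simpl never.

(** * Harmonic polynomials and harmonicity of the family *)

Section Harmonic.
Variables (F : fieldType) (charF0 : [pchar F] =i pred0) (k : nat).
Implicit Types (p q : {mpoly F[k.+1 + k.+1]}) (m : 'X_{1..k.+1 + k.+1}).
Implicit Types (i : 'X_{1..k}) (z : bool) (l : bool -> nat).

Definition harmonic l p :=
  lap p = 0 /\ forall z m, p@_m != 0 -> sdeg z m = l z.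

Lemma harmonic0 l : harmonic l 0.
Proof. by split=> [|z m]; rewrite raddf0 ?eqxx. Qed.

Lemma harmonicZD l a p q :
  harmonic l p -> harmonic l q -> harmonic l (a *: p + q).
Proof.
move=> [p0 pl] [q0 ql]; split=> [|z m].
  by rewrite linearP /= p0 q0 scaler0 addr0.
rewrite mcoeffD mcoeffZ; have [p_eq0|/pl //] := eqVneq p@_m 0.
by rewrite p_eq0 mulr0 add0r => /ql.
Qed.

Lemma harmonic_op l z s t p : harmonic l p -> harmonic l (op z s t p).
Proof.
move=> [p0 pl]; split=> [|z' m]; first by rewrite lap_op p0 raddf0.
(* Each product in [op] trades one variable for another of the same side, so the bidegree is
   kept. *)
have hX z1 s' t' :
    ('X_(var z1 s') * p^`M(var z1 t'))@_m != 0 -> sdeg z' m = l z'.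
  rewrite mcoeffXM mcoeff_deriv; case: ifP => [ms|]; last by rewrite eqxx.
  rewrite -mulr_natr mulf_eq0 negb_or => /andP[/(pl z') h _].
  by rewrite -(submUK ms) -h !sdegD !sdegU.
rewrite mcoeffB; have [->|/hX //] := eqVneq ('X_(var z s) * p^`M(var z t))@_m 0.
by rewrite sub0r oppr_eq0 => /hX.
Qed.

Lemma harmonic_sl_submodule l : sl_submodule (harmonic l).
Proof.
split; [exact: harmonic0|by move=> *; exact: harmonicZD|move=> A p _ hp].
have hD q q' : harmonic l q -> harmonic l q' -> harmonic l (q + q').
  by move=> hq hq'; rewrite -[q]scale1r; exact: harmonicZD.
rewrite gl_actE; apply: big_ind => [||s _]; [exact: harmonic0|exact: hD|].
apply: big_ind => [||t _]; [exact: harmonic0|exact: hD|].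
by rewrite -[_ *: _]addr0; apply: harmonicZD (harmonic0 l); exact: harmonic_op.
Qed.

Definition leading m :=
  (m (var true ord0) == 0%N) || (m (var false ord0) == 0%N).

Lemma leadingP m : reflect (exists z, m (var z ord0) = 0%N) (leading m).
Proof.
apply: (iffP orP) => [[]/eqP|[[] ->]]; [by exists true|by exists false| |];
  by [left|right].
Qed.

(* Comparing coefficients at m - x_1 - y_1 in the Laplace equation expresses the
   coefficient of a monomial m divisible by x_1 y_1 through coefficients of
   monomials with smaller exponent of x_1. *)
Lemma lap0_leading_eq0 p :
  lap p = 0 -> (forall m, leading m -> p@_m = 0) -> p = 0.
Proof.
move=> p0 pl; apply/mpolyP => m; rewrite mcoeff0.
have [a] := ubnP (m (var true ord0)); elim: a m => // a IH m ma.
have [/pl //|] := boolP (leading m); rewrite negb_or => /andP[mx my].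
have := congr1 (mcoeff (m - U_(var true ord0) - U_(var false ord0))%MM) p0.
rewrite mcoeff0 mcoeff_lap big_ord_recl /= big1 => [|t _]; last first.
  by rewrite IH ?mul0rn // !mnmDE !mnmBE !mnm1E !eq_var /=; lia.
set c := (_ * _)%N; have -> : (m - U_(var true ord0) - U_(var false ord0) +
    U_(var false ord0) + U_(var true ord0))%MM = m.
  apply/mnmP; apply: varP => z t; rewrite !mnmDE !mnmBE !mnm1E !eq_var.
  by case: z; rewrite ?andbF ?andTb //=; case: eqP => [<-|_]; lia.
move/eqP; rewrite addr0 -mulr_natr mulf_eq0 => /orP[/eqP //|].
by rewrite (negPf (natr_neq0 charF0 _)) // muln_eq0.
Qed.

Definition side z m : 'X_{1..k} := [multinom m (var z (lift ord0 r)) | r < k].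

Lemma sdegE z m : sdeg z m = (m (var z ord0) + mdeg (side z m))%N.
Proof.
rewrite /sdeg big_ord_recl mdegE; congr addn.
by apply: eq_bigr => r _; rewrite mnmE.
Qed.

Definition var_index (s : 'I_(k.+1 + k.+1)) : 'I_k.+1 :=
  match split s with inl t => t | inr t => t end.

Lemma var_indexK z t : var_index (var z t) = t.
Proof.
rewrite /var_index; case: z;
  by rewrite /var ?(unsplitK (inl _)) ?(unsplitK (inr _)).
Qed.

(** The monomial of the summand at [i] when [m] is the leading one; subtraction truncates as in
    [bmonom]. *)
Definition descend m i : 'X_{1..k.+1 + k.+1} :=
  [multinom if unlift ord0 (var_index s) is Some r then (m s - i r)%N
            else (m s + mdeg i)%N | s < k.+1 + k.+1].

Lemma descend0 m i z : descend m i (var z ord0) = (m (var z ord0) + mdeg i)%N.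
Proof. by rewrite mnmE var_indexK unlift_none. Qed.

Lemma descendS m i z r :
  descend m i (var z (lift ord0 r)) = (side z m r - i r)%N.
Proof. by rewrite !mnmE var_indexK liftK. Qed.

Lemma descend_0 m : descend m 0%MM = m.
Proof.
apply/mnmP; apply: varP => z t; case: (unliftP ord0 t) => [r|] ->.
  by rewrite descendS !mnmE subn0.
by rewrite descend0 mdeg0 addn0.
Qed.

Lemma leading_descend m i : leading (descend m i) -> i = 0%MM.
Proof.
case/leadingP => z; rewrite descend0 => /eqP.
by rewrite addn_eq0 mdeg_eq0 => /andP[_ /eqP].
Qed.

(** The parameter m or m' of the family is the exponent of x_1 or y_1; for a leading [m] the other
    exponent is 0, so the sum covers both cases. *)
Definition belem_coef m i :=
  bcoef F (m (var true ord0) + m (var false ord0))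
    (side true m) (side false m) i.

(* The basis element with leading monomial m, i.e. xelem or yelem according to
   whether x_1 or y_1 divides m. *)
Definition belem m : {mpoly F[k.+1 + k.+1]} :=
  \sum_(i : 'X_{1..k < (mdeg (side true m)).+1})
    belem_coef m i *: 'X_[descend m i].

Lemma belem_coef_neq0 m i z r :
  belem_coef m i != 0 -> (i r <= side z m r)%N.
Proof.
apply: contra_neqT; rewrite -ltnNge => h; apply: (@bcoef_eq0 _ _ _ _ _ _ r).
by case: z h => ->; rewrite ?orbT.
Qed.

Lemma mcoeff_belem_neq0 m m' : (belem m)@_m' != 0 ->
  exists2 i, belem_coef m i != 0 & m' = descend m i.
Proof.
have [i /andP[c0 /eqP e] _|h] := pickP
  (fun i : 'X_{1..k < (mdeg (side true m)).+1} =>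
    (belem_coef m i != 0) && (m' == descend m i)); first by exists i.
rewrite raddf_sum big1 ?eqxx //= => i _; rewrite mcoeffZ mcoeffX eq_sym.
have := h i; have [->|_ /= ->] := eqVneq (belem_coef m i) 0.
  by rewrite mul0r.
by rewrite mulr0.
Qed.

(** A summand with i != 0 is divisible by x_1 y_1, so only the one at i = 0, of coefficient 1,
    contributes. *)
Lemma mcoeff_belem_leading m m' : leading m' -> (belem m)@_m' = (m == m')%:R.
Proof.
move=> lm'; rewrite raddf_sum (bigD1 bm0) //= big1 => [|i].
  by rewrite mcoeffZ mcoeffX /belem_coef bcoef0 descend_0 mul1r addr0.
rewrite mcoeffZ mcoeffX; case: (descend m i =P m') => [e|_ _]; last first.
  by rewrite mulr0.
move: lm'; rewrite -e => /leading_descend i0 /eqP[].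
by apply/val_inj.
Qed.

Lemma mcoeff_belem_weight m m' : (belem m)@_m' != 0 ->
  (m' (var true ord0) + m (var false ord0) =
   m' (var false ord0) + m (var true ord0))%N.
Proof. by case/mcoeff_belem_neq0 => i _ ->; rewrite !descend0; lia. Qed.

(** Where the coefficient is nonzero no subtraction truncates, so the other variables of a side lose
    exactly the |i| that its first variable gains. *)
Lemma sdeg_belem z m m' : (belem m)@_m' != 0 -> sdeg z m' = sdeg z m.
Proof.
case/mcoeff_belem_neq0 => i c0 ->; rewrite !sdegE descend0 -addnA; congr addn.
rewrite !mdegE -big_split; apply: eq_bigr => r _ /=.
rewrite [side z (descend m i) r]mnmE descendS subnKC //.
exact: belem_coef_neq0.
Qed.

Lemma big_bmultinom_addU (M : nmodType) (E : 'X_{1..k} -> M) (r : 'I_k) K :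
  \sum_(i : 'X_{1..k < K}) E (i + U_(r))%MM =
  \sum_(i : 'X_{1..k < K.+1} | (0 < i r)%N) E i.
Proof.
have upP (i : 'X_{1..k < K}) : (mdeg (i + U_(r)) < K.+1)%N.
  by rewrite mdegD mdeg1 addn1 ltnS bmdeg.
(* For K = 0 the left index type is empty, while [bm0], the default of [insubd] below, needs a
   positive bound. *)
case: K upP => [|K] upP.
  rewrite !big1 // => [i ir|i]; last by have := bmdeg i.
  have := bmdeg i; rewrite ltnS leqn0 mdeg_eq0 => /eqP i0.
  by move: ir; rewrite i0 mnm0E.
rewrite [RHS](reindex_onto (fun i : 'X_{1..k < K.+1} => BMultinom (upP i))
  (fun i : 'X_{1..k < K.+2} =>
     insubd (bm0 : 'X_{1..k < K.+1}) (i - U_(r))%MM)) /=.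
  apply: eq_bigl => i; rewrite mnmDE mnm1E eqxx addn1 ltn0Sn; apply/esym/eqP.
  by apply/val_inj; rewrite /= val_insubd addmK bmdeg.
move=> i ir; have e := submUK ir.
apply/val_inj; rewrite /= val_insubd.
suff -> : (mdeg (i - U_(r))%MM < K.+1)%N by [].
by have := bmdeg i; rewrite -{1}e mdegD mdeg1 addn1.
Qed.

(** With Y_i the summand's monomial divided by x_1 y_1, the first pair of derivatives yields (w+|i|)
    |i| c_i Y_i. By [bcoef_addU], and after renaming i + U_r as i, pair r yields -(w+|i|) i_r c_i
    Y_i. The i_r add up to |i|. *)
Lemma lap_belem m : leading m -> lap (belem m) = 0.
Proof.
move=> lm; set K := (mdeg (side true m)).+1; set c := belem_coef m.
pose w := (m (var true ord0) + m (var false ord0))%N.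
pose Y i : {mpoly F[_]} :=
  'X_[descend m i - U_(var true ord0) - U_(var false ord0)].
have lapX i : lap (c i *: 'X_[descend m i]) =
    ((w + mdeg i) * mdeg i)%:R *: (c i *: Y i) -
    \sum_r ((w + (mdeg i).+1) * (i r).+1)%:R *:
       (c (i + U_(r))%MM *: Y (i + U_(r))%MM).
  rewrite linearZ /= /lap big_ord_recl scalerDr; congr (_ + _).
    rewrite !mderivX !mderivZ !mderivX !mnmBE mnm1E eq_var subn0 !descend0.
    rewrite !scalerA; congr (_ *: _); rewrite -natrM mulrC; congr (_%:R * _).
    (* One of the exponents of x_1 and y_1 in [m] is 0 and the other is [w], so differentiation
       gives the factors |i| and w+|i|. *)
    by case/leadingP: lm => -[] e; rewrite /w e; lia.
  rewrite scaler_sumr -sumrN; apply: eq_bigr => r _.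
  rewrite !mderivX !mderivZ !mderivX !mnmBE mnm1E eq_var subn0 !descendS.
  rewrite !scalerA -natrM /c /belem_coef bcoef_addU // (addnS w) -scaleNr mulNr.
  rewrite -/(belem_coef m (i + U_(r))%MM) -/c -/w.
  (* A nonzero coefficient at i + U_r ensures that no subtraction truncates, so the two monomials
     agree. *)
  have [->|c0] := eqVneq (c (i + U_(r))%MM) 0.
    by rewrite !mulr0 oppr0 !scale0r.
  congr (_ *: 'X_[_]).
  apply/mnmP; apply: varP => z t; rewrite !mnmBE !mnm1E !eq_var.
  case: (unliftP ord0 t) => [u|] ->.
    rewrite !descendS mnmDE mnm1E.
    have := belem_coef_neq0 z u c0; rewrite mnmDE mnm1E.
    rewrite !(inj_eq lift_inj) => cz; case: (r =P u) cz => [<-|_];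
      by case: z => /=; lia.
  by rewrite !descend0 mdegD mdeg1; case: z => /=; lia.
rewrite /belem -/c -/K raddf_sum /=.
under eq_bigr => i _ do rewrite lapX.
rewrite sumrB exchange_big /=.
apply/eqP; rewrite subr_eq0; apply/eqP.
pose E r i := ((w + mdeg i) * i r)%:R *: (c i *: Y i).
transitivity
  (\sum_r \sum_(i : 'X_{1..k < K.+1} | (0 < i r)%N) E r i); last first.
  apply: eq_bigr => r _; rewrite -(big_bmultinom_addU (E r)).
  by apply: eq_bigr => i _; rewrite /E mdegD mdeg1 mnmDE mnm1E eqxx !addn1.
transitivity (\sum_r \sum_(i : 'X_{1..k < K.+1}) E r i); last first.
  apply: eq_bigr => r _; rewrite [RHS]big_mkcond; apply: eq_bigr => i _ /=.
  by case: ifPn => //; rewrite /E -eqn0Ngt => /eqP ->; rewrite muln0 scale0r.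
rewrite exchange_big.
(* The coefficients vanish once |i| exceeds K - 1, the degree of [side true m], so the bound K + 1
   drops to K. *)
rewrite [RHS](@big_bmultinom_trunc _ _ (fun i => \sum_r E r i) K.-1) //;
    last first.
  move=> i hi; rewrite big1 // => r _.
  by rewrite /E /c /belem_coef bcoef_mdeg // scale0r scaler0.
by apply: eq_bigr => i _; rewrite -scaler_suml -natr_sum -big_distrr /= -mdegE.
Qed.

Lemma harmonic_belem m : leading m -> harmonic (fun z => sdeg z m) (belem m).
Proof. by move=> lm; split=> [|z m']; [exact: lap_belem|exact: sdeg_belem]. Qed.

End Harmonic.

(** * The family as a basis of the harmonic polynomials *)

Section Basis.
Variables (F : fieldType) (charF0 : [pchar F] =i pred0) (k : nat).
Implicit Types (p q : {mpoly F[k.+1 + k.+1]}) (m : 'X_{1..k.+1 + k.+1}).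
Implicit Types (i : 'X_{1..k}) (z : bool) (l : bool -> nat) (s t : 'I_k.+1).

Lemma harmonic_eq l p q : harmonic l p -> harmonic l q ->
  (forall m, leading m -> p@_m = q@_m) -> p = q.
Proof.
move=> hp hq e; apply/eqP; rewrite -subr_eq0; apply/eqP.
have [h0 _] : harmonic l (- 1 *: q + p) by exact: harmonicZD.
apply: (lap0_leading_eq0 charF0); first by rewrite addrC -scaleN1r.
by move=> m /e em; rewrite mcoeffB em subrr.
Qed.

Lemma harmonic_belem_eq l m :
  leading m -> (forall z, sdeg z m = l z) -> harmonic l (belem F m).
Proof.
move=> /(harmonic_belem charF0)[lap0 hm] ml; split=> // z m' /hm ->.
exact: ml.
Qed.

Lemma harmonic_belemE l p : harmonic l p ->
  p = \sum_(m <- msupp p | leading m) p@_m *: belem F m.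
Proof.
move=> hp; apply: (harmonic_eq hp).
  rewrite big_seq_cond; apply: (big_ind (harmonic l)).
  - exact: harmonic0.
  - by move=> q q' hq hq'; rewrite -[q]scale1r; exact: harmonicZD.
  move=> m /andP[mp lm]; rewrite -[_ *: _]addr0.
  apply: harmonicZD (harmonic0 _ _ l).
  apply: harmonic_belem_eq => // z; apply: hp.2.
  by rewrite -mcoeff_msupp.
move=> m lm; rewrite raddf_sum /=.
under eq_bigr => m' _ do rewrite mcoeffZ mcoeff_belem_leading //.
have [mp|mp] := boolP (m \in msupp p).
  rewrite (big_rem m) //= lm eqxx mulr1 big1_seq ?addr0 // => m' /andP[_].
  by rewrite mem_rem_uniq ?msupp_uniq // => /andP[/negPf-> _]; rewrite mulr0.
rewrite (memN_msupp_eq0 mp) big1_seq // => m' /andP[_ mp'].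
by case: eqP mp' mp => [-> ->|]; rewrite ?mulr0.
Qed.

Definition monom (e : bool -> nat) (u : bool -> 'X_{1..k}) :
    'X_{1..k.+1 + k.+1} :=
  [multinom match split s with
            | inl t => oapp (u true) (e true) (unlift ord0 t)
            | inr t => oapp (u false) (e false) (unlift ord0 t)
            end | s < k.+1 + k.+1].

Lemma monom0 e u z : monom e u (var z ord0) = e z.
Proof.
rewrite mnmE; case: z;
  by rewrite /var ?(unsplitK (inl _)) ?(unsplitK (inr _)) unlift_none.
Qed.

Lemma monomS e u z r : monom e u (var z (lift ord0 r)) = u z r.
Proof.
rewrite mnmE; case: z;
  by rewrite /var ?(unsplitK (inl _)) ?(unsplitK (inr _)) liftK.
Qed.

Lemma side_monom e u z : side z (monom e u) = u z.
Proof. by apply/mnmP => r; rewrite mnmE monomS. Qed.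

Lemma bmonomE m i :
  bmonom F (m (var true ord0) + mdeg i) (m (var false ord0) + mdeg i)
    (side true m) (side false m) i = 'X_[descend m i].
Proof.
rewrite mpolyXE_id big_split_ord /= !big_ord_recl /=.
rewrite -!(descend0, descendS) /bmonom /xvar /yvar big_split /= mulrACA.
by congr (_ * _ * (_ * _)); apply: eq_bigr => r _; rewrite -descendS.
Qed.

Lemma xelemE m : m (var false ord0) = 0%N ->
  xelem F (m (var true ord0)) (side true m) (side false m) = belem F m.
Proof.
move=> m0; apply: eq_bigr => i _; rewrite /xterm /belem_coef -bmonomE m0.
by rewrite addn0 add0n.
Qed.

Lemma yelemE m : m (var true ord0) = 0%N ->
  yelem F (m (var false ord0)) (side true m) (side false m) = belem F m.
Proof.
move=> m0; apply: eq_bigr => i _; rewrite /yterm /belem_coef -bmonomE m0.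
by rewrite !add0n.
Qed.

Definition bideg (l1 l2 : nat) z := if z then l1 else l2.

(** The leading monomial encodes the parameters: a missing y_1 gives the first family, a missing x_1
    the second. If both are missing, the two families give the same polynomial. *)
Lemma basis_setP (l1 l2 : nat) p :
  basis_set l1 l2 p <->
  exists m, [/\ leading m, forall z, sdeg z m = bideg l1 l2 z & p = belem F m].
Proof.
split=> [[]|].
- move=> [m [mm [ll [e1 e2 ->]]]].
  exists (monom (fun z => if z then m else 0%N) (fun z => if z then mm else ll)).
  split.
  + by apply/leadingP; exists false; rewrite monom0.
  + by case; rewrite sdegE monom0 side_monom.
  + by rewrite -xelemE ?monom0 // !side_monom.
- move=> [m [mm [ll [e1 e2 ->]]]].
  exists (monom (fun z => if z then 0%N else m) (fun z => if z then mm else ll)).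
  split.
  + by apply/leadingP; exists true; rewrite monom0.
  + by case; rewrite sdegE monom0 side_monom.
  + by rewrite -yelemE ?monom0 // !side_monom.
move=> [m [/leadingP[z m0] sm ->]].
have := sm true; have := sm false; rewrite !sdegE.
case: z m0 => m0; rewrite m0 add0n => e2 e1.
  right; exists (m (var false ord0)), (side true m), (side false m).
  by rewrite yelemE.
left; exists (m (var true ord0)), (side true m), (side false m).
by rewrite xelemE.
Qed.

(** In a vanishing combination, the coefficient at a member's leading monomial is that member's
    scalar, since no other member contains this monomial. *)
Lemma lin_indep_basis_set (l1 l2 : nat) : lin_indep (@basis_set F k l1 l2).
Proof.
move=> s c us sB s0 v vs.
have /basis_setP[m [lm _ vE]] := sB _ vs.
have := congr1 (mcoeff m) s0; rewrite mcoeff0 raddf_sum (big_rem v) //=.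
rewrite mcoeffZ vE mcoeff_belem_leading // eqxx mulr1 big1_seq ?addr0 // => w.
rewrite -vE mem_rem_uniq // => /= /andP[wv ws].
have /basis_setP[m' [lm' _ wE]] := sB _ ws.
rewrite mcoeffZ wE mcoeff_belem_leading //.
case: eqP => [e|_]; last by rewrite mulr0.
by move: wv; rewrite wE vE e eqxx.
Qed.

Lemma harmonic_in_span (l1 l2 : nat) p :
  harmonic (bideg l1 l2) p -> in_span (@basis_set F k l1 l2) p.
Proof.
move=> hp; set S := [seq m <- msupp p | leading m].
have uS : uniq S by rewrite filter_uniq ?msupp_uniq.
(* The scalar must be a function of the vector: at [belem F m] with [m] in [S] this sum reduces to
   [p@_m], as [m] is its only leading monomial. *)
exists [seq belem F m | m <- S], (fun v => \sum_(m <- S) v@_m * p@_m); split.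
  move=> v /mapP[m]; rewrite mem_filter => /andP[lm mp] ->.
  apply/basis_setP; exists m; split=> // z; apply: hp.2.
  by rewrite -mcoeff_msupp.
rewrite big_map {1}(harmonic_belemE hp) -(big_filter _ (@leading k)) -/S.
apply: eq_big_seq => m mS; congr (_ *: _).
rewrite (big_rem m) //= mcoeff_belem_leading ?eqxx ?mul1r; last first.
  by move: mS; rewrite mem_filter => /andP[].
rewrite big1_seq ?addr0 // => m' /andP[_].
rewrite mem_rem_uniq // => /andP[/= mm'].
rewrite mem_filter => /andP[lm' _]; rewrite mcoeff_belem_leading // eq_sym.
by rewrite (negPf mm') mul0r.
Qed.

(** * Reaching the basis elements inside a submodule *)

Variable W : {mpoly F[k.+1 + k.+1]} -> Prop.
Hypothesis slW : sl_submodule W.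

Lemma submoduleZ (a : F) p : a != 0 -> W (a *: p) -> W p.
Proof.
case: slW => W0 Wl _ a0 /(Wl a^-1 _ 0)/(_ W0).
by rewrite addr0 scalerA mulVf // scale1r.
Qed.

Lemma submodule_in_span (B : {mpoly F[k.+1 + k.+1]} -> Prop) p :
  (forall q, B q -> W q) -> in_span B p -> W p.
Proof.
case: slW => W0 Wl _ BW [s [c [sB ->]]]; elim: s sB => [|q s IH] sB.
  by rewrite big_nil.
rewrite big_cons; apply: Wl; first by apply/BW/sB; rewrite mem_head.
by apply: IH => v vs; apply: sB; rewrite inE vs orbT.
Qed.

(** The hypothesis on [m] kills the second product of [op z s t]; the first leaves a positive
    integer as scalar, invertible in characteristic 0. *)
Lemma submodule_mnm_step z s t m : s != t -> m (var (~~ z) s) = 0%N ->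
  W 'X_[m + U_(var z t)] -> W 'X_[m + U_(var z s)].
Proof.
move=> st m0 /(sl_submodule_op z slW st).
rewrite /op !mderivX mnmDE mnm1E eqxx addn1 mnmDE m0 mnm1E eq_var.
have -> : (z == ~~ z) = false by case: z {m0}.
rewrite scale0r mulr0 subr0 -scalerAr addmK -mpolyXD [(U_(_) + m)%MM]addmC.
by apply/submoduleZ/natr_neq0.
Qed.

Lemma submodule_mnm_steps z s t m c : s != t -> m (var (~~ z) s) = 0%N ->
  W 'X_[m + U_(var z t) *+ c] -> W 'X_[m + U_(var z s) *+ c].
Proof.
move=> st; elim: c m => [|c IH] m m0 //; rewrite !mulmS !addmA => /IH.
have neq : (z == ~~ z) = false by case: z {m0 IH}.
rewrite mnmDE m0 mnm1E eq_var neq => /(_ erefl).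
rewrite -!addmA ![(U_(_) + _ *+ _)%MM]addmC !addmA.
apply: submodule_mnm_step => //.
by rewrite mnmDE m0 mulmnE mnm1E eq_var neq.
Qed.

(** Induction on the number of factors of side [~~ z] away from index [r]: each is obtained by
    moving one factor from [r]. *)
Lemma submodule_mnm z a b r : r != ord0 ->
  W 'X_[U_(var z ord0) *+ a + U_(var (~~ z) r) *+ b] ->
  forall m, sdeg z m = a -> sdeg (~~ z) m = b -> m (var (~~ z) ord0) = 0%N ->
    (forall t, t != ord0 -> m (var z t) = 0%N) -> W 'X_[m].
Proof.
move=> r0 W0 m; have neq : (~~ z == z) = false by case: z {W0}.
have [d] := ubnP (b - m (var (~~ z) r)); elim: d m => // d IH m md sa sb m0 mz.
have [/existsP[t /andP[tr mt]]|] :=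
  boolP [exists t, (t != r) && (0 < m (var (~~ z) t))%N].
  have t0 : t != ord0 by apply: contraTneq mt => ->; rewrite m0.
  have rb : (m (var (~~ z) r) < b)%N.
    rewrite -sb /sdeg (bigD1 r) //= (bigD1 t) //=; lia.
  have mE := esym (submUK mt).
  rewrite mE; set m' := (m - _)%MM in mE *.
  apply: (@submodule_mnm_step _ _ r) => //.
    by rewrite negbK /m' mnmBE mz.
  have m'E z' u : m' (var z' u) = (m (var z' u) - ((~~ z == z') && (t == u)))%N.
    by rewrite mnmBE mnm1E eq_var.
  move: sa sb; rewrite {1}mE [in sdeg (~~ z) _]mE !sdegD !sdegU => sa sb.
  apply: IH; rewrite ?sdegD ?sdegU //.
  - rewrite mnmDE mnm1E eqxx m'E eqxx (negPf tr) /=; lia.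
  - by rewrite mnmDE mnm1E m'E m0 eq_var (negPf r0) andbF.
  - by move=> u u0; rewrite mnmDE mnm1E m'E mz // eq_var neq.
move=> /existsPn h.
suff -> : m = (U_(var z ord0) *+ a + U_(var (~~ z) r) *+ b)%MM by [].
have ma : m (var z ord0) = a.
  by rewrite -sa /sdeg (bigD1 ord0) //= big1 ?addn0.
have mb : m (var (~~ z) r) = b.
  rewrite -sb /sdeg (bigD1 r) //= big1 ?addn0 // => t tr.
  by apply/eqP; move: (h t); rewrite tr /= -eqn0Ngt.
apply/mnmP; apply: varP => z' t; rewrite mnmDE !mulmnE !mnm1E !eq_var.
have [<-|zz'] := eqVneq z z'.
  rewrite neq; have [<-|t0] := eqVneq ord0 t; first by rewrite ma; lia.
  by rewrite mz 1?eq_sym //; lia.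
have -> : z' = ~~ z by case: (z) (z') zz' => [] [].
rewrite eqxx; have [<-|tr] := eqVneq r t; first by rewrite mb; lia.
by apply/eqP; move: (h t); rewrite eq_sym tr /= -eqn0Ngt => /eqP ->; lia.
Qed.

(* Both sides are harmonic, so only leading coefficients matter; as the exponent
   of var z ord0 minus that of var (~~ z) ord0 is constant and positive on the
   basis element, only its leading monomial contributes to them. *)
Lemma op_belem z m t : t != ord0 -> m (var (~~ z) ord0) = 0%N ->
  op z t ord0 (belem F (m + U_(var z ord0))%MM) =
  (m (var z ord0)).+1%:R *: belem F (m + U_(var z t))%MM.
Proof.
move=> t0 m0; have neq : (z == ~~ z) = false by case: (z).
have t0' : (t == ord0) = false by exact: negPf.
set m1 := (m + U_(var z ord0))%MM; set m2 := (m + U_(var z t))%MM.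
have lm1 : leading m1.
  by apply/leadingP; exists (~~ z); rewrite mnmDE m0 mnm1E eq_var neq.
have lm2 : leading m2.
  by apply/leadingP; exists (~~ z); rewrite mnmDE m0 mnm1E eq_var neq.
have weight m' : (belem F m1)@_m' != 0 ->
    (m' (var z ord0) = m' (var (~~ z) ord0) + (m (var z ord0)).+1)%N.
  move/mcoeff_belem_weight; rewrite !mnmDE !mnm1E !eq_var.
  by case: (z) m0 => /= ->; lia.
apply: (@harmonic_eq (fun z' => sdeg z' m1)).
- by apply/harmonic_op/harmonic_belem.
- rewrite -[_ *: _]addr0; apply: harmonicZD (harmonic0 _ _ _).
  by apply: harmonic_belem_eq => // z'; rewrite !sdegD !sdegU.
move=> m' lm'; rewrite /op mcoeffB !mcoeffXM !mcoeff_deriv mcoeffZ.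
rewrite mcoeff_belem_leading //.
have m2E : m2 == m' -> m' (var (~~ z) ord0) = 0%N.
  by move=> /eqP <-; rewrite mnmDE m0 mnm1E eq_var neq.
have neqN : (~~ z == z) = false by rewrite eq_sym.
have [m'0|m'0] := posnP (m' (var (~~ z) ord0)).
  rewrite subr0 [in RHS]mulr_natl.
  have m2t : m2 == m' -> (0 < m' (var z t))%N.
    by move=> /eqP <-; rewrite mnmDE mnm1E eqxx addn1.
  case: ifPn => [m't|/(contraNF m2t)->]; last by rewrite mul0rn.
  rewrite mcoeff_belem_leading; last first.
    apply/leadingP; exists (~~ z).
    by rewrite mnmDE mnmBE m'0 !mnm1E !eq_var neq.
  have -> : (m1 == m' - U_(var z t) + U_(var z ord0))%MM = (m2 == m').
    apply/eqP/eqP => [/mnmP e|<-]; last by rewrite addmK.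
    apply/mnmP => u; move: (e u); rewrite /m1 /m2 !mnmDE mnmBE !mnm1E.
    by case: (var z t =P u) => [<-|_]; lia.
  case: eqP => [<-|_]; last by rewrite !mul0rn.
  by rewrite mnmBE mnmDE !mnm1E !eq_var eqxx t0' addn0 subn0.
have /negPf-> : m2 != m' by apply/negP => /m2E e; rewrite e in m'0.
rewrite mulr0.
have m'z : m' (var z ord0) = 0%N.
  case/leadingP: lm' => z' e; have [<- //|zz'] := eqVneq z' z.
  have zE : z' = ~~ z by case: (z) (z') zz' => [] [].
  by move: m'0; rewrite -zE e.
have b0 m3 : (m3 (var z ord0) <= m3 (var (~~ z) ord0))%N ->
    (belem F m1)@_m3 = 0.
  by move=> h; apply/eqP; apply: contraTT h => /weight ->; lia.
rewrite !b0 ?mul0rn ?if_same ?subr0 //.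
  by rewrite !mnmDE !mnmBE !mnm1E !eq_var m'z ?neq ?neqN ?eqxx ?t0' /=; lia.
by rewrite !mnmDE !mnmBE !mnm1E !eq_var m'z ?neq ?neqN ?eqxx ?t0' /=; lia.
Qed.

(** No x_t y_t divides the monomial, so each mixed derivative in [lap] kills it. *)
Lemma harmonic_mpolyX l m : (forall z, sdeg z m = l z) ->
  (forall t, (m (var true t) == 0%N) || (m (var false t) == 0%N)) ->
  harmonic l ('X_[m] : {mpoly F[_]}).
Proof.
move=> ml m0; split=> [|z m']; last first.
  by rewrite mcoeffX; case: (m =P m') => [<-|]; rewrite ?ml ?eqxx.
rewrite /lap big1 // => t _; rewrite mderivX mderivZ mderivX scalerA -natrM.
rewrite mnmBE mnm1E eq_var subn0 (_ : (_ * _)%N = 0%N) ?scale0r //.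
by apply/eqP; rewrite muln_eq0.
Qed.

(** Induction on the number of factors of side [z] other than [var z ord0]: [op_belem] produces each
    of them from a factor [var z ord0]. *)
Lemma submodule_belem z a b r : r != ord0 ->
  W 'X_[U_(var z ord0) *+ a + U_(var (~~ z) r) *+ b] ->
  forall m, sdeg z m = a -> sdeg (~~ z) m = b -> m (var (~~ z) ord0) = 0%N ->
    W (belem F m).
Proof.
move=> r0 W0 m; have [d] := ubnP (a - m (var z ord0)).
elim: d m => // d IH m md sa sb m0.
have neq : (z == ~~ z) = false by case: (z).
have [/existsP[t /andP[t0 mt]]|] :=
  boolP [exists t, (t != ord0) && (0 < m (var z t))%N].
  have ma : (m (var z ord0) < a)%N.
    rewrite -sa /sdeg (bigD1 ord0) //= (bigD1 t) //=; lia.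
  have mE := esym (submUK mt).
  have m'E : (m - U_(var z t))%MM (var z ord0) = m (var z ord0).
    by rewrite mnmBE mnm1E eq_var eqxx (negPf t0) subn0.
  move: sa sb m0; rewrite mE; set m' := (m - _)%MM in m'E *.
  rewrite !sdegD !sdegU mnmDE mnm1E eq_var neq addn0 => sa sb m0.
  apply: (submoduleZ (natr_neq0 charF0 (isT : (m' (var z ord0)).+1 != 0%N))).
  rewrite -op_belem //; apply: sl_submodule_op => //.
  apply: IH; rewrite ?sdegD ?sdegU //.
    by rewrite mnmDE mnm1E eqxx m'E; lia.
  by rewrite mnmDE m0 mnm1E eq_var neq.
move=> /existsPn h.
have mz t : t != ord0 -> m (var z t) = 0%N.
  by move=> t0; apply/eqP; move: (h t); rewrite t0 /= -eqn0Ngt.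
(* Here no x_t y_t divides [m], so the monomial is harmonic and has the same leading coefficients as
   the basis element. *)
suff -> : belem F m = 'X_[m] by apply: (submodule_mnm r0 W0).
apply: (@harmonic_eq (fun z' => sdeg z' m)).
- by apply: harmonic_belem => //; apply/leadingP; exists (~~ z).
- apply: harmonic_mpolyX => // t.
  have [->|/mz] := eqVneq t ord0.
    by case: (z) m0 => /= ->; rewrite eqxx ?orbT.
  by case: (z) => ->; rewrite eqxx ?orbT.
by move=> m' lm'; rewrite mcoeff_belem_leading // mcoeffX.
Qed.

End Basis.

(** * The two inclusions between the generated submodule and the span *)

Theorem theorem4p3 (F : fieldType) (charF0 : [pchar F] =i pred0)
  (k : nat) (n_ge3 : (3 <= k.+1)%N) (l1 l2 : nat) :
  is_basis (@basis_set F k l1 l2)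
    (sl_generated (@xvar F k.+1 ord0 ^+ l1 * @yvar F k.+1 ord_max ^+ l2)).
Proof.
have max0 : ord_max != ord0 :> 'I_k.+1 by rewrite -val_eqE /= -lt0n; lia.
have gE : @xvar F k.+1 ord0 ^+ l1 * @yvar F k.+1 ord_max ^+ l2 =
    'X_[U_(var true ord0) *+ l1 + U_(var false ord_max) *+ l2].
  by rewrite mpolyXD -!mpolyXn.
split; first exact: lin_indep_basis_set.
move=> p; split.
  (* The harmonic polynomials form a submodule, and the generator lies in it because x_1 and y_n
     have different indices. *)
  move=> /(_ (harmonic (bideg l1 l2)) (harmonic_sl_submodule _ _ _)) hp.
  apply: harmonic_in_span => //; apply: hp; rewrite gE.
  apply: harmonic_mpolyX => [z|t].
    by rewrite sdegD !sdegMn !sdegU /bideg; case: z; rewrite /= ?mul1n ?addn0.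
  rewrite !mnmDE !mulmnE !mnm1E !eq_var /=.
  by have [<-|_] := eqVneq ord0 t; rewrite ?(negPf max0) !mul0n ?orbT.
move=> pB W slW; rewrite gE => Wg; apply: (submodule_in_span slW _ pB) => q.
move/basis_setP => [m [lm sm ->]].
have := sm true; have := sm false; rewrite /bideg => m2 m1.
case/leadingP: lm => -[] m0; last exact: (submodule_belem charF0 slW max0 Wg).
(* An index other than the first and the last, from n >= 3. Moving x_1^l1 to x_r^l1 needs y_r
   absent, hence r != n; moving y_n^l2 to y_1^l2 afterwards needs x_1 absent, hence r != 1. The
   rewriting below does these moves in reverse. *)
pose r : 'I_k.+1 := inord 1.
have rE : r = 1%N :> nat by rewrite inordK //; lia.
have r0 : r != ord0 by rewrite -val_eqE /= rE.
have rmax : r != ord_max by rewrite -val_eqE /= rE; lia.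
apply: (submodule_belem (z := false) charF0 slW r0 _ m2 m1 m0).
rewrite addmC; apply: (submodule_mnm_steps charF0 slW (t := ord_max)).
  by rewrite eq_sym.
  by rewrite mulmnE mnm1E eq_var /= (negPf r0).
rewrite addmC; apply: (submodule_mnm_steps (z := true) charF0 slW r0).
  by rewrite mulmnE mnm1E eq_var /= eq_sym (negPf rmax).
by rewrite addmC.
Qed.
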